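(* Assume that $T^\#T$ and $V^\#V$ are indefinite operators on $\mathcal{H}$ and that $[Ty,Ty]_{\mathcal{K}}\geq 0$ for every $y\in\mathcal{C}_V$. Given $(w_0,z_0)\in\mathcal{K}\times\mathcal{E}$, let $\widetilde{x}\in\mathcal{H}$. Then $\widetilde{x}\in\mathcal{Z}(w_0,z_0)$ if and only if there exists $\lambda\in[\rho_-,\rho_+]$ such that $$(T^\#T+\lambda V^\#V)\widetilde{x}=T^\#w_0+\lambda V^\#z_0,$$ and $$[V\widetilde{x}-z_0,V\widetilde{x}-z_0]_{\mathcal{E}}=0.$$
   Context: $(\mathcal{H},\langle\cdot,\cdot\rangle)$ is a complex separable Hilbert space, $(\mathcal{K},[\cdot,\cdot]_{\mathcal{K}})$ and $(\mathcal{E},[\cdot,\cdot]_{\mathcal{E}})$ are complex Krein spaces (boundedness of operators and topologies refer to the norm of any associated Hilbert space). $T:\mathcal{H}\to\mathcal{K}$ is a bounded linear operator with closed range and $V:\mathcal{H}\to\mathcal{E}$ is a bounded linear surjective operator. $T^\#:\mathcal{K}\to\mathcal{H}$ and $V^\#:\mathcal{E}\to\mathcal{H}$ denote the adjoints, determined by $[Tx,w]_{\mathcal{K}}=\langle x,T^\#w\rangle$ and $[Vx,z]_{\mathcal{E}}=\langle x,V^\#z\rangle$ for all $x\in\mathcal H$, $w\in\mathcal K$, $z\in\mathcal E$. A selfadjoint operator $A$ on $\mathcal{H}$ is indefinite if it is neither positive nor negative semidefinite. $\mathcal{C}_V=\{y\in\mathcal{H}: [Vy,Vy]_{\mathcal{E}}=0\}$,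 $\mathcal{P}^+(V)=\{x\in\mathcal{H}:[Vx,Vx]_{\mathcal{E}}>0\}$, $\mathcal{P}^-(V)=\{x\in\mathcal{H}:[Vx,Vx]_{\mathcal{E}}<0\}$. $$\rho_-:=-\inf_{x\in\mathcal{P}^+(V)}\frac{[Tx,Tx]_{\mathcal{K}}}{[Vx,Vx]_{\mathcal{E}}},\qquad \rho_+:=-\sup_{x\in\mathcal{P}^-(V)}\frac{[Tx,Tx]_{\mathcal{K}}}{[Vx,Vx]_{\mathcal{E}}}.$$ When $T(\mathcal{C}_V)$ is nonnegative these are real numbers with $\rho_-\le\rho_+$. For $(w_0,z_0)\in\mathcal{K}\times\mathcal{E}$, $\mathcal{Z}(w_0,z_0)$ is the set of vectors at which the minimum of $[Tx-w_0,Tx-w_0]_{\mathcal{K}}$ over $\{x\in\mathcal{H}:[Vx-z_0,Vx-z_0]_{\mathcal{E}}=0\}$ is attained (empty if the minimum does not exist). *)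

(* Defs.v *)
From HB Require Import structures.
From mathcomp Require Import all_boot all_order all_algebra.
From mathcomp Require Import sesquilinear.
From mathcomp Require Import complex.
From mathcomp Require Import all_classical all_reals all_analysis.

Set Implicit Arguments.
Unset Strict Implicit.
Unset Printing Implicit Defensive.

Import Order.TTheory GRing.Theory Num.Theory.
Import numFieldNormedType.Exports.

Local Open Scope classical_set_scope.
Local Open Scope complex_scope.
Local Open Scope ring_scope.

(* All forms are linear in the first argument and conjugate-linear in the
   second.  The order of R[i] is the partial one: [0 <= z] means that [z] is
   real and nonnegative. *)

Definition induces_norm (R : realType) (H : normedModType R[i])
    (form : H -> H -> R[i]) : Prop :=
  forall x, form x x = `|x| ^+ 2.

Definition separable (X : topologicalType) : Prop :=
  exists2 D : set X, countable D & dense D.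

(* When H is complete, [closed A] makes A complete, so that A with the form is
   a Hilbert space whose norm is the restriction of the norm of H. *)
Definition hilbert_subspace (R : realType) (H : normedModType R[i])
    (form : H -> H -> R[i]) (A : set H) : Prop :=
  [/\ A 0,
      forall (a : R[i]) x y, A x -> A y -> A (a *: x + y),
      closed A
    & forall x, A x -> form x x = `|x| ^+ 2].

(* K = Kp [+] Km with (Kp, form) and (Km, - form) Hilbert spaces, the norm of K
   being the one of the associated Hilbert space, whose inner product is
   [xp, yp] - [xm, ym]. *)
Definition fundamental_decomposition (R : realType) (K : normedModType R[i])
    (form : K -> K -> R[i]) (Kp Km : set K) : Prop :=
  [/\ hilbert_subspace form Kp /\
        hilbert_subspace (fun x y => - form x y) Km,
      Kp `&` Km = [set 0],
      forall x, exists xp xm, [/\ Kp xp, Km xm & x = xp + xm],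
      forall xp xm, Kp xp -> Km xm -> form xp xm = 0
    & forall xp xm, Kp xp -> Km xm ->
        `|xp + xm| ^+ 2 = form xp xp - form xm xm].

Definition krein_space (R : realType) (K : completeNormedModType R[i])
    (form : {hermitian_sym K for @Num.conj R[i]}) : Prop :=
  exists Kp Km : set K, fundamental_decomposition form Kp Km.

(* The value of [get] is meaningful because, by the Riesz representation
   theorem, such a vector [u] exists and is unique when T is bounded. *)
Definition adjoint (R : realType) (H K : normedModType R[i])
    (ip : H -> H -> R[i]) (form : K -> K -> R[i]) (T : H -> K) (w : K) : H :=
  get [set u : H | forall x, form (T x) w = ip x u].

Definition positive_semidefinite (R : realType) (H : normedModType R[i])
    (ip : H -> H -> R[i]) (A : H -> H) : Prop :=
  forall x, 0 <= ip (A x) x.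

Definition negative_semidefinite (R : realType) (H : normedModType R[i])
    (ip : H -> H -> R[i]) (A : H -> H) : Prop :=
  forall x, ip (A x) x <= 0.

Definition indefinite (R : realType) (H : normedModType R[i])
    (ip : H -> H -> R[i]) (A : H -> H) : Prop :=
  ~ positive_semidefinite ip A /\ ~ negative_semidefinite ip A.

Section QuadraticForms.
Variables (R : realType) (H K E : normedModType R[i]).
Variables (fK : K -> K -> R[i]) (fE : E -> E -> R[i]).
Variables (T : H -> K) (V : H -> E).

Definition neutral_cone : set H := [set y | fE (V y) (V y) = 0].

Definition positive_cone : set H := [set x | 0 < fE (V x) (V x)].

Definition negative_cone : set H := [set x | fE (V x) (V x) < 0].

(* For Hermitian forms the quotient is real, so [Re] only changes its type. *)
Definition form_ratio (x : H) : R :=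
  complex.Re (fK (T x) (T x) / fE (V x) (V x)).

Definition rho_minus : R := - inf (form_ratio @` positive_cone).

Definition rho_plus : R := - sup (form_ratio @` negative_cone).

Definition feasible (z0 : E) : set H :=
  [set x | fE (V x - z0) (V x - z0) = 0].

Definition minimizers (w0 : K) (z0 : E) : set H :=
  [set x | feasible z0 x /\
    forall y, feasible z0 y ->
      fK (T x - w0) (T x - w0) <= fK (T y - w0) (T y - w0)].

End QuadraticForms.

(* Main.v *)
Require Import Defs.
From HB Require Import structures.
From mathcomp Require Import all_boot all_order all_algebra.
From mathcomp Require Import sesquilinear.
From mathcomp Require Import complex.
From mathcomp Require Import all_classical all_reals all_analysis.
From mathcomp Require Import ring lra.

Set Implicit Arguments.
Unset Strict Implicit.
Unset Printing Implicit Defensive.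

Import Order.TTheory GRing.Theory Num.Theory.
Import numFieldNormedType.Exports.

Local Open Scope classical_set_scope.
Local Open Scope complex_scope.
Local Open Scope ring_scope.

(* Expanding around x, y is feasible iff [Vh, Vh] + 2 Re [Vh, Vx - z0] = 0 with
   h = y - x, and x is optimal iff [Th, Th] + 2 Re [Th, Tx - w0] >= 0 for all
   such h.  Homogenizing both expressions by an extra complex coordinate s gives
   two Hermitian forms on H * C, the first nonnegative on the neutral vectors of
   the second.  By the S-lemma for complex Hermitian forms (Krein-Smul'jan) some
   pencil A + l B of the homogenized forms is nonnegative; restricted to s = 0
   this says that l lies in [rho_-, rho_+], and since (0, 1) is a null vector of
   the pencil it lies in its kernel, which is the stationarity equation.  The
   converse is the expansion around x. *)

(** * Complex Hermitian forms and the interval of nonnegative pencils *)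

Section HermitianForms.
Variables (R : realType) (W : lmodType R[i]).
Implicit Types (A B : W -> W -> R[i]) (u v w h : W).

Definition hermitian_form B :=
  (forall w, scalar (B^~ w)) /\ (forall u v, B u v = (B v u)^*).

Definition quad B h : R := complex.Re (B h h).

Section OneForm.
Variable B : W -> W -> R[i].
Hypothesis hB : hermitian_form B.

Lemma hermitian_formDl u v w : B (u + v) w = B u w + B v w.
Proof. by have := hB.1 w 1 u v; rewrite scale1r mul1r. Qed.

Lemma hermitian_form0l w : B 0 w = 0.
Proof. by apply: (addrI (B 0 w)); rewrite -hermitian_formDl !addr0. Qed.

Lemma hermitian_formZl (a : R[i]) u w : B (a *: u) w = a * B u w.
Proof. by have := hB.1 w a u 0; rewrite !addr0 hermitian_form0l addr0. Qed.

Lemma hermitian_formDr u v w : B w (u + v) = B w u + B w v.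
Proof. by rewrite hB.2 hermitian_formDl rmorphD /= -!hB.2. Qed.

Lemma hermitian_formZr (a : R[i]) u w : B w (a *: u) = a^* * B w u.
Proof. by rewrite hB.2 hermitian_formZl rmorphM /= -hB.2. Qed.

Lemma quadE h : B h h = (quad B h)%:C.
Proof.
rewrite /quad; have := hB.2 h h; case: (B h h) => a b /= [] /eqP.
by rewrite -subr_eq0 opprK -mulr2n mulrn_eq0 /= => /eqP ->.
Qed.

Lemma quadD u v : quad B (u + v) = quad B u + quad B v + 2 * complex.Re (B u v).
Proof.
rewrite /quad hermitian_formDl !hermitian_formDr [B v u]hB.2.
case: (B u u) (B v v) (B u v) => [? ?] [? ?] [? ?] /=; ring.
Qed.

Lemma quadZ (a : R[i]) u : quad B (a *: u) = complex.Re (a * a^*) * quad B u.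
Proof.
rewrite /quad hermitian_formZl hermitian_formZr mulrA quadE.
by case: a => a b /=; ring.
Qed.

(** A nonzero [b = B u v] would let a small step from [v] along [- b^* u] make the form negative. *)
Lemma quad_ge0_null v :
  (forall h, 0 <= quad B h) -> quad B v = 0 -> forall u, B u v = 0.
Proof.
move=> B0 Bv u.
(* As [t * quad B u = 1 - t], the form at the perturbed vector is [- t (1 + t) |b|^2]. *)
pose b := B u v; pose t := (quad B u + 1)^-1.
have q1 : 0 < quad B u + 1 by rewrite ltr_wpDl.
have := B0 (((- t)%:C * b^*) *: u + v).
rewrite quadD Bv addr0 quadZ hermitian_formZl -/b.
have t0 : 0 < t by rewrite invr_gt0.
have tq : t * quad B u = 1 - t by rewrite /t; field; lra.
case: b => x y /= => B0'.
have xy0 : x ^+ 2 + y ^+ 2 = 0.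
  apply/eqP; rewrite eq_le addr_ge0 ?sqr_ge0// andbT leNgt; apply/negP => xy.
  have : 0 < t * (1 + t) * (x ^+ 2 + y ^+ 2) by rewrite !mulr_gt0// addr_gt0.
  rewrite -oppr_lt0; apply/negP; rewrite -leNgt.
  rewrite (_ : - _ = t * (t * quad B u) * (x ^+ 2 + y ^+ 2)
                     - 2 * t * (x ^+ 2 + y ^+ 2)); last by rewrite tq; ring.
  by move: B0'; congr (0 <= _); ring.
by move/eqP: xy0; rewrite paddr_eq0 ?sqr_ge0// !sqrf_eq0 => /andP[/eqP-> /eqP->].
Qed.

End OneForm.

(* With c chosen so that [Re B x (c y)] = 0 and B (c y) = - B x, both vectors
   x + c y and x - c y are neutral; add the two values of A. *)
Lemma neutral_cross A B x y : hermitian_form A -> hermitian_form B ->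
  (forall h, quad B h = 0 -> 0 <= quad A h) ->
  0 < quad B x -> quad B y < 0 ->
  quad A x * quad B y <= quad A y * quad B x.
Proof.
move=> hA hB AB Bx By.
have [c [c0 cB]] : exists c : R[i], 0 < complex.Re (c * c^*) /\
    complex.Re (c^* * B x y) = 0.
  case: (B x y) => p q; have [pq0|pq0] := eqVneq (p ^+ 2 + q ^+ 2) 0.
    exists (1 +i* 0); rewrite /=; split; first by lra.
    move/eqP: pq0; rewrite paddr_eq0 ?sqr_ge0// !sqrf_eq0.
    by move=> /andP[/eqP-> _]; ring.
  (* This is ['i * B x y], so [c^* * B x y] is [- 'i |B x y|^2], purely imaginary. *)
  exists ((- q) +i* p); rewrite /=; split; last by ring.
  rewrite (_ : _ - _ = p ^+ 2 + q ^+ 2); last by ring.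
  by rewrite lt_def pq0 addr_ge0// sqr_ge0.
set N := complex.Re (c * c^*) in c0.
pose t := Num.sqrt (- quad B x / (N * quad B y)).
have tE : t ^+ 2 * N * quad B y = - quad B x.
  have NBy : N * quad B y < 0 by rewrite pmulr_rlt0.
  rewrite sqr_sqrtr; first by field; rewrite lt_eqF// gt_eqF.
  by rewrite mulr_le0// ?invr_le0 ?oppr_le0 ltW.
have quadx C (s : R) : hermitian_form C -> quad C (x + (s%:C * c) *: y) =
    quad C x + s ^+ 2 * N * quad C y + 2 * s * complex.Re (c^* * C x y).
  move=> hC; rewrite quadD// quadZ// hermitian_formZr// /N.
  by case: (c) (C x y) => ? ? [? ?]; rewrite /=; ring.
have Bt (s : R) : s ^+ 2 = t ^+ 2 -> quad B (x + (s%:C * c) *: y) = 0.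
  by move=> st; rewrite quadx// cB st tE; ring.
have := AB _ (Bt t erefl); have := AB _ (Bt (- t) (sqrrN t)).
rewrite !quadx// => A1 A2.
have A3 : 0 <= quad A x + t ^+ 2 * N * quad A y by move: A1 A2; rewrite sqrrN; lra.
rewrite -subr_ge0.
rewrite (_ : _ - _ = - quad B y * (quad A x + t ^+ 2 * N * quad A y)).
  by rewrite mulr_ge0// oppr_ge0 ltW.
by rewrite -[quad B x]opprK -tE; ring.
Qed.

(** The endpoints rho_- and rho_+ for an arbitrary pair of forms, so that they also apply to the
    homogenized pair. *)
Definition lower_slope A B : R :=
  - inf [set quad A h / quad B h | h in [set h | 0 < quad B h]].

Definition upper_slope A B : R :=
  - sup [set quad A h / quad B h | h in [set h | quad B h < 0]].

(** By [neutral_cross] every ratio on the negative cone is at most every ratio on the positive cone,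
    so the sup and the inf are finite and ordered. Dividing the pencil inequality by [quad B h],
    according to its sign, places [- l] between them. *)
Lemma pencil_interval A B : hermitian_form A -> hermitian_form B ->
  (exists h, 0 < quad B h) -> (exists h, quad B h < 0) ->
  (forall h, quad B h = 0 -> 0 <= quad A h) ->
  lower_slope A B <= upper_slope A B /\
  forall l : R, (forall h, 0 <= quad A h + l * quad B h) <->
    lower_slope A B <= l <= upper_slope A B.
Proof.
move=> hA hB [p Bp] [n Bn] AB; rewrite /lower_slope /upper_slope.
set P := (X in inf X); set N := (X in sup X).
have NP a b : N a -> P b -> a <= b.
  move=> [y /= By <-] [x /= Bx <-].
  rewrite ler_ndivrMr// mulrAC ler_pdivrMr//.
  exact: neutral_cross.
have P0 : P !=set0 by exists (quad A p / quad B p), p.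
have N0 : N !=set0 by exists (quad A n / quad B n), n.
have [[a Na] [b Pb]] := (N0, P0).
have lP : has_inf P by split=> //; exists a => x; apply: NP.
have uN : has_sup N by split=> //; exists b => x /NP; apply.
have NlP : sup N <= inf P.
  by apply: sup_le_ub => // x Nx; apply: lb_le_inf => // y; apply: NP.
split; first by rewrite lerN2.
move=> l; have -> : (- inf P <= l <= - sup N) = (sup N <= - l <= inf P).
  by move: (inf P) (sup N) => i s; rewrite lerNl lerNr andbC.
split=> [ABl | /andP[lN lP'] h].
  apply/andP; split.
    apply: sup_le_ub => // _ [x /= Bx <-]; rewrite ler_ndivrMr//.
    by have := ABl x; lra.
  apply: lb_le_inf => // _ [x /= Bx <-]; rewrite ler_pdivlMr//.
  by have := ABl x; lra.
have [Bh|Bh|Bh] := ltgtP (quad B h) 0.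
- have : quad A h / quad B h <= - l.
    by apply: le_trans lN; apply: ub_le_sup (uN.2) _ _; exists h.
  by rewrite ler_ndivrMr//; lra.
- have : - l <= quad A h / quad B h.
    by apply: (le_trans lP'); apply: ge_inf (lP.2) _ _; exists h.
  by rewrite ler_pdivlMr//; lra.
- by rewrite Bh mulr0 addr0 AB.
Qed.

End HermitianForms.

(** * Real pencils of Hermitian forms *)

Section Pencil.
Variables (R : realType) (W : lmodType R[i]).
Implicit Types (A B : W -> W -> R[i]).

Definition pencil A B (l : R) : W -> W -> R[i] :=
  fun u v => A u v + l%:C * B u v.

Lemma hermitian_pencil A B (l : R) :
  hermitian_form A -> hermitian_form B -> hermitian_form (pencil A B l).
Proof.
rewrite /pencil => hA hB; split=> [w c u v|u v].
  rewrite /= (hermitian_formDl hA) (hermitian_formZl hA) (hermitian_formDl hB).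
  by rewrite (hermitian_formZl hB); ring.
rewrite (hA.2 u v) (hB.2 u v); case: (A v u) (B v u) => ? ? [? ?].
  by apply/eqP; rewrite eq_complex /=; apply/andP; split; apply/eqP; ring.
Qed.

Lemma quad_pencil A B (l : R) h :
  quad (pencil A B l) h = quad A h + l * quad B h.
Proof.
by rewrite /quad /pencil; case: (A h h) (B h h) => ? ? [? ?] /=; ring.
Qed.

End Pencil.

Lemma scalar0 (R : realType) (W : lmodType R[i]) (c : W -> R[i]) :
  scalar c -> c 0 = 0.
Proof. by move=> lc; have := lc (-1) 0 0; rewrite scaler0 addr0 mulN1r addNr. Qed.

(** * Homogenization and the inhomogeneous S-lemma *)

Section Homogenization.
Variables (R : realType) (W : lmodType R[i]).
Implicit Types (A B : W -> W -> R[i]) (a b : W -> R[i]).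

(** There is no [|s|^2] term: the constant term of the constraint vanishes at a feasible base point,
    and that of the objective cancels against its value there. Hence (0, 1) is null for both
    forms. *)
Definition homogenize B b (p q : W * R[i]^o) : R[i] :=
  B p.1 q.1 + ((q.2 : R[i])^* * b p.1 + (p.2 : R[i]) * (b q.1)^*).

Lemma hermitian_homogenize B b :
  hermitian_form B -> scalar b -> hermitian_form (homogenize B b).
Proof.
rewrite /homogenize => hB lb; split=> [[w r] c [u s] [v t]|[u s] [v t]] /=.
  rewrite (hermitian_formDl hB) (hermitian_formZl hB) lb.
  rewrite /GRing.scale /=; ring.
rewrite (hB.2 u v); case: (B v u) (b u) (b v) s t => ? ? [? ?] [? ?] [? ?] [? ?].
by apply/eqP; rewrite eq_complex /=; apply/andP; split; apply/eqP; ring.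
Qed.

Lemma quad_homogenize0 B b h : quad (homogenize B b) (h, 0) = quad B h.
Proof.
rewrite /quad /homogenize /=.
by case: (B h h) (b h) => ? ? [? ?] /=; ring.
Qed.

Lemma quad_homogenize1 B b h :
  quad (homogenize B b) (h, 1) = quad B h + 2 * complex.Re (b h).
Proof.
rewrite /quad /homogenize /=.
by case: (B h h) (b h) => ? ? [? ?] /=; ring.
Qed.

Lemma inhomogeneous_multiplier A B a b :
  hermitian_form A -> hermitian_form B -> scalar a -> scalar b ->
  (exists h, 0 < quad B h) -> (exists h, quad B h < 0) ->
  (forall h, quad B h = 0 -> 0 <= quad A h) ->
  (forall h, quad B h + 2 * complex.Re (b h) = 0 ->
     0 <= quad A h + 2 * complex.Re (a h)) ->
  exists l : R, (forall h, 0 <= quad A h + l * quad B h) /\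
    forall h, a h + l%:C * b h = 0.
Proof.
move=> hA hB la lb [p Bp] [n Bn] AB AB1.
have hA' := hermitian_homogenize hA la; have hB' := hermitian_homogenize hB lb.
have AB' q : quad (homogenize B b) q = 0 -> 0 <= quad (homogenize A a) q.
  case: q => h s; have [->|s0] := eqVneq s 0.
    by rewrite !quad_homogenize0; apply: AB.
  (* Scaling by [s] multiplies both forms by [|s|^2 > 0], which reduces to [s = 1]. *)
  have -> : (h, s) = (s : R[i]) *: ((s : R[i])^-1 *: h, 1).
    transitivity ((s : R[i]) *: ((s : R[i])^-1 *: h), (s : R[i]) * 1) => //.
    by rewrite scalerA divff// scale1r mulr1.
  rewrite (quadZ hA') (quadZ hB') !quad_homogenize1.
  have s2 : 0 < complex.Re (s * s^*).
    have : 0 < `|s : R[i]| ^+ 2 by rewrite exprn_gt0// normr_gt0.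
    by rewrite sqr_normc ltcE => /andP[].
  move=> /eqP; rewrite mulf_eq0 gt_eqF//= => /eqP /AB1.
  by move=> ?; rewrite mulr_ge0// ltW.
have [||sl pen] := pencil_interval hA' hB' _ _ AB'.
  by exists (p, 0); rewrite quad_homogenize0.
  by exists (n, 0); rewrite quad_homogenize0.
(* Any point of the interval would serve; it contains its left endpoint because it is nonempty. *)
exists (lower_slope (homogenize A a) (homogenize B b)).
set l := lower_slope _ _.
have /pen pos : l <= l <= upper_slope (homogenize A a) (homogenize B b).
  by rewrite lexx.
split=> h.
  by have := pos (h, 0); rewrite !quad_homogenize0.
have hC := hermitian_pencil l hA' hB'.
have := quad_ge0_null hC (v := (0, 1) : W * R[i]^o).
have -> : quad (pencil (homogenize A a) (homogenize B b) l) (0, 1) = 0.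
  rewrite quad_pencil !quad_homogenize1 !scalar0// /quad.
  rewrite (hermitian_form0l hA) (hermitian_form0l hB).
  by rewrite mulr0 /= !(mulr0, addr0).
(* The pencil at (h, 0) and (0, 1) equals [a h + l%:C * b h]. *)
move=> /(_ _ erefl (h, 0)).
rewrite /pencil /homogenize /= (hA.2 h) (hB.2 h).
rewrite (hermitian_form0l hA) (hermitian_form0l hB).
case: (a h) (a 0) (b h) (b 0) => ? ? [? ?] [? ?] [? ?] E.
rewrite -[RHS]E; last by move=> q; rewrite quad_pencil; apply: pos.
by apply/eqP; rewrite eq_complex /=; apply/andP; split; apply/eqP; ring.
Qed.

End Homogenization.

(** * The Riesz representation theorem *)

Section Riesz.
Variables (R : realType) (H : completeNormedModType R[i]).
Variable ip : H -> H -> R[i].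
Hypotheses (hip : hermitian_form ip) (hH : induces_norm ip).

Definition rnorm (V : normedModType R[i]) (x : V) : R := complex.Re `|x|.

Lemma rnormE (V : normedModType R[i]) (x : V) : `|x| = (rnorm x)%:C.
Proof. by rewrite /rnorm RRe_real// normr_real. Qed.

Lemma rnorm_ge0 (V : normedModType R[i]) (x : V) : 0 <= rnorm x.
Proof. by rewrite -ler0c -rnormE. Qed.

Lemma quad_ip x : quad ip x = rnorm x ^+ 2.
Proof. by rewrite /quad hH rnormE -rmorphXn. Qed.

(* The representing vector minimizes |x|^2 - 2 Re (f x); the parallelogram
   identity makes the sublevel sets of this functional a Cauchy filter. *)
Lemma riesz (f : H -> R[i]) (C : R) : scalar f ->
  (forall x, complex.Re (f x) <= C * rnorm x) ->
  exists u, forall x, f x = ip x u.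
Proof.
move=> lf fC.
have fD x y : f (x + y) = f x + f y.
  by have := lf 1 x y; rewrite scale1r mul1r.
have f0 := scalar0 lf.
have fZ a x : f (a *: x) = a * f x by have := lf a x 0; rewrite f0 !addr0.
pose J x := quad ip x - 2 * complex.Re (f x).
have JD x h : J (x + h) = J x + quad ip h + 2 * complex.Re (ip h x - f h).
  rewrite /J [x + h]addrC quadD// fD.
  by case: (f x) (f h) (ip h x) => ? ? [? ?] [? ?] /=; ring.
have Jpar x y : quad ip (x - y) = 2 * (J x + J y) - 4 * J (2^-1%:C *: (x + y)).
  rewrite /J -scaleN1r !(quadD, quadZ)// fZ fD hermitian_formZr//.
  by case: (f x) (f y) (ip x y) => ? ? [? ?] [? ?] /=; field.
pose S := [set J x | x in setT].
have S0 : S !=set0 by exists (J 0), 0.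
have infS : has_inf S.
  split=> //; exists (- C ^+ 2) => _ [x _ <-].
  (* [J x >= |x|^2 - 2 C |x| = (|x| - C)^2 - C^2]. *)
  rewrite /J quad_ip; have := fC x; have := sqr_ge0 (rnorm x - C); nra.
set m := inf S.
have mJ x : m <= J x by apply: ge_inf (infS.2) _ _; exists x.
have Jm d : 0 < d -> exists x, J x < m + d.
  by move=> d0; have [_ [x _ <-] ?] := inf_adherent d0 infS; exists x.
pose F := filter_from [set d : R | 0 < d] (fun d => [set x | J x < m + d]).
have FF : ProperFilter F.
  apply: filter_from_proper; last by move=> d /Jm.
  apply: filter_from_filter; first by exists 1 => /=.
  move=> d e /= d0 e0; exists (Num.min d e) => /=.
    by rewrite lt_min d0.
  by move=> x /=; rewrite -ltrBlDl lt_min !ltrBlDl => /andP[].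
have : cauchy F.
  apply: cauchy_exP => e e0.
  have [r eE] : exists r : R, e = r%:C.
    by exists (complex.Re e); rewrite RRe_real// gtr0_real.
  move: e0; rewrite eE ltcR => r0.
  (* Two points with [J < m + d] and a midpoint with [J >= m] satisfy [|x - y|^2 < 4 d] by [Jpar],
     below [r^2 = 8 d]. *)
  pose d := r ^+ 2 / 8.
  have d0 : 0 < d by rewrite divr_gt0// exprn_gt0.
  have [x xd] := Jm d d0; exists x, d => //= y /= yd.
  rewrite -ball_normE /= rnormE ltcR.
  rewrite -(ltr_pXn2r (n := 2)) ?nnegrE ?rnorm_ge0 ?ltW//.
  rewrite -quad_ip Jpar.
  have -> : r ^+ 2 = 8 * d by rewrite /d; field.
  have := mJ (2^-1%:C *: (x + y)); lra.
move=> /cauchy_cvg/cvg_ex[u Fu]; exists u.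
have Re0 h : complex.Re (ip h u - f h) = 0.
  (* First-order condition at [u] up to [d], without continuity of [J]: take a near-minimizer [x]
     close to [u] and use [m <= J (x + t h)]. The cross term [ip h (u - x)] is absorbed through
     [0 <= |t h + (u - x)|^2], which doubles the coefficient of [t^2]. *)
  have small (t d : R) : 0 < d ->
      0 <= 2 * t * complex.Re (ip h u - f h) + 2 * t ^+ 2 * quad ip h + d.
    move=> d0; have d2 : 0 < d / 2 by rewrite divr_gt0.
    have s0 : 0 < Num.sqrt (d / 2) by rewrite sqrtr_gt0.
    have Fball : F (ball u (Num.sqrt (d / 2))%:C).
      by apply/Fu/nbhsx_ballx; rewrite ltcR.
    have Fm : F [set x | J x < m + d / 2] by exists (d / 2).
    have [x [ux /= xm]] := filter_ex (filterI Fball Fm).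
    have ux2 : quad ip (u - x) < d / 2.
      move: ux; rewrite -ball_normE /= rnormE ltcR quad_ip => ux.
      by rewrite -[ltRHS]sqr_sqrtr ?ltW// ltr_pXn2r// nnegrE ?rnorm_ge0 ?sqrtr_ge0.
    have := mJ (x + t%:C *: h); have : 0 <= quad ip (t%:C *: h + (u - x)).
      by rewrite quad_ip sqr_ge0.
    rewrite JD (quadD hip) !(quadZ hip) !(hermitian_formZl hip) fZ.
    have -> : ip h u = ip h x + ip h (u - x) by rewrite -hermitian_formDr// subrKC.
    by case: (ip h x) (ip h (u - x)) (f h) => ? ? [? ?] [? ?] /=; lra.
  set b := complex.Re _ in small *; set q := quad ip h in small *.
  have q0 : 0 <= q by rewrite /q quad_ip sqr_ge0.
  apply/eqP; apply: contraT => b0.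
  have b2 : 0 < b ^+ 2 by rewrite exprn_even_gt0.
  pose k := (q + 1)^-1; have k0 : 0 < k by rewrite invr_gt0 ltr_wpDl.
  have qk : q = k^-1 - 1 by rewrite invrK addrK.
  (* With this [d] and [t = - b k / 2], the relation [k q = 1 - k] makes the right-hand side
     [- b^2 k^2 / 2 < 0]. *)
  have /small : 0 < b ^+ 2 * k / 2 by apply: divr_gt0 => //; apply: mulr_gt0.
  move=> /(_ (- b * k / 2)); rewrite [X in 0 <= X](_ : _ = - (b ^+ 2 * k ^+ 2 / 2)).
    by rewrite oppr_ge0 leNgt divr_gt0// mulr_gt0// exprn_gt0.
  by rewrite qk; field; rewrite gt_eqF.
move=> h; apply/esym/eqP; rewrite -subr_eq0.
(* Testing with ['i *: h] recovers the imaginary part. *)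
have := Re0 h; have := Re0 ('i *: h).
rewrite hermitian_formZl// fZ; case: (ip h u) (f h) => a b [c d] /= ? ?.
apply/eqP; congr Complex; lra.
Qed.

End Riesz.

(** * Continuity of the Krein form *)

Section Krein.
Variables (R : realType) (K : completeNormedModType R[i]).
Variable fK : {hermitian_sym K for @Num.conj R[i]}.

Lemma hermitian_sym_form : hermitian_form fK.
Proof.
split=> [w a u v|u v]; first by rewrite linearPl.
by rewrite hermitian_subproof expr0 mul1r.
Qed.

(** Along a fundamental decomposition the form is [|xp|^2 - |xm|^2], while the squared norm is
    [|xp|^2 + |xm|^2]. *)
Lemma krein_quad_le x : krein_space fK -> `|quad fK x| <= rnorm x ^+ 2.
Proof.
move=> [Kp [Km [[[_ _ _ Kpn] [_ _ _ Kmn]] _ dec orth nrm]]].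
have hK := hermitian_sym_form.
have [xp [xm [Kxp Kxm ->]]] := dec x.
have := congr1 (@complex.Re R) (nrm _ _ Kxp Kxm).
have := congr1 (@complex.Re R) (Kpn _ Kxp).
have := congr1 (@complex.Re R) (Kmn _ Kxm).
rewrite !(quadE hK) !rnormE -!rmorphXn /= => xm2 xp2 ->.
rewrite (quadD hK) orth//= mulr0 addr0.
by have := sqr_ge0 (rnorm xp); have := sqr_ge0 (rnorm xm); rewrite ler_norml; lra.
Qed.

(** Polarization on unit vectors, [4 Re [z, w] = [z + w, z + w] - [z - w, z - w]], then scaling. The
    constant is crude, but [riesz] only asks for some bound at fixed [w]. *)
Lemma krein_form_le y w : krein_space fK ->
  complex.Re (fK y w) <= (1 + rnorm w) ^+ 2 / 2 * rnorm y.
Proof.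
move=> kK; have hK := hermitian_sym_form.
have unit z : rnorm z = 1 -> complex.Re (fK z w) <= (1 + rnorm w) ^+ 2 / 2.
  move=> z1; have tri s : `|s| = 1 -> rnorm (z + s *: w) ^+ 2 <= (1 + rnorm w) ^+ 2.
    move=> s1; rewrite ler_pXn2r ?nnegrE ?addr_ge0 ?rnorm_ge0//.
    have := ler_normD z (s *: w).
    by rewrite normrZ s1 mul1r !rnormE z1 lecE => /andP[].
  have := le_trans (krein_quad_le _ kK) (tri 1 (normr1 _)).
  have := le_trans (krein_quad_le _ kK) (tri (-1) (normrN1 _)).
  rewrite !(quadD hK) !(quadZ hK) !(hermitian_formZr hK) !ler_norml.
  by case: (fK z w) => a b /= /andP[? ?] /andP[? ?]; lra.
have [->|y0] := eqVneq y 0.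
  by rewrite (hermitian_form0l hK) /rnorm normr0 /= mulr0.
have y1 : 0 < rnorm y by rewrite -ltcR -rnormE normr_gt0.
rewrite -ler_pdivrMr//.
have /unit : rnorm ((rnorm y)^-1%:C *: y) = 1.
  apply: complexI; rewrite -rnormE normrZ rnormE ger0_norm ?lecR ?invr_ge0 ?ltW//.
  by rewrite -rmorphM mulVf ?gt_eqF.
by rewrite (hermitian_formZl hK); case: (fK y w) => a b /=; rewrite mul0r subr0 mulrC.
Qed.

End Krein.

(** * Existence of the adjoint *)

Section Adjoint.
Variables (R : realType) (H K : completeNormedModType R[i]).
Variable ip : {dot H for @Num.conj R[i]}.
Variable fK : {hermitian_sym K for @Num.conj R[i]}.
Variable T : {linear H -> K}.

Lemma dot_form : hermitian_form ip.
Proof.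
split=> [w a u v|u v]; first by rewrite linearPl.
by rewrite hermitian_subproof expr0 mul1r.
Qed.

(** Since [adjoint] is a [get], a representing vector must be shown to exist: [riesz] gives it for
    [x |-> [T x, w]], bounded by [krein_form_le] and the boundedness of [T]. *)
Lemma adjointE : induces_norm ip -> krein_space fK -> continuous T ->
  forall x w, fK (T x) w = ip x (adjoint ip fK T w).
Proof.
move=> hH kK cT x w; have hK := hermitian_sym_form fK.
suff [u uE] : exists u, forall x, fK (T x) w = ip x u.
  exact: (@getPex _ [set u | forall x, fK (T x) w = ip x u] (ex_intro _ u uE)).
have [M MT] : exists M : R, forall x, rnorm (T x) <= M * rnorm x.
  have /linear_boundedP[M0 [M0r MT]] := continuous_linear_bounded 0 (cT 0).
  have M1r : M0 + 1 \is Num.real by rewrite realD ?real1.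
  exists (complex.Re (M0 + 1)) => y.
  by rewrite -lecR rmorphM /= -!rnormE RRe_real// MT// ltrDl.
apply: (riesz dot_form hH (C := (1 + rnorm w) ^+ 2 / 2 * M)).
  by move=> a y z; rewrite linearP (hermitian_formDl hK) (hermitian_formZl hK).
move=> y; apply: le_trans (krein_form_le _ _ kK) _.
by rewrite -[leRHS]mulrA ler_wpM2l// divr_ge0// sqr_ge0.
Qed.

Lemma hermitian_comp : hermitian_form (fun x y => fK (T x) (T y)).
Proof.
have hK := hermitian_sym_form fK; split=> [w a u v|u v]; last exact: hK.2.
by rewrite linearP (hermitian_formDl hK) (hermitian_formZl hK).
Qed.

End Adjoint.

(** * The interval endpoints and the expansion around a point *)

Section Slopes.
Variables (R : realType) (H K E : completeNormedModType R[i]).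
Variable fK : {hermitian_sym K for @Num.conj R[i]}.
Variable fE : {hermitian_sym E for @Num.conj R[i]}.
Variables (T : {linear H -> K}) (V : {linear H -> E}).

Let A := fun x y => fK (T x) (T y).
Let B := fun x y => fE (V x) (V y).

Lemma form_ratioE h : form_ratio fK fE T V h = quad A h / quad B h.
Proof.
have [hA hB] := (hermitian_comp fK T, hermitian_comp fE V).
by rewrite /form_ratio (quadE hA) (quadE hB) -fmorphV /= mul0r subr0.
Qed.

Lemma rho_minusE : rho_minus fK fE T V = lower_slope A B.
Proof.
rewrite /rho_minus /lower_slope; congr (- inf _).
have -> : positive_cone fE V = [set h | 0 < quad B h].
  apply/seteqP; split=> h /=; rewrite /positive_cone /=;
  by rewrite (quadE (hermitian_comp fE V)) ltcR.
by apply: eq_imagel => h _; rewrite form_ratioE.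
Qed.

Lemma rho_plusE : rho_plus fK fE T V = upper_slope A B.
Proof.
rewrite /rho_plus /upper_slope; congr (- sup _).
have -> : negative_cone fE V = [set h | quad B h < 0].
  apply/seteqP; split=> h /=; rewrite /negative_cone /=;
  by rewrite (quadE (hermitian_comp fE V)) ltcR.
by apply: eq_imagel => h _; rewrite form_ratioE.
Qed.

(** Serves both for the objective, with [T] and [w0], and for the constraint, with [V] and [z0]. *)
Lemma quad_shift w x y : quad fK (T y - w) =
  quad A (y - x) + 2 * complex.Re (fK (T (y - x)) (T x - w)) + quad fK (T x - w).
Proof.
have -> : T y - w = T (y - x) + (T x - w) by rewrite linearB addrA subrK.
by rewrite (quadD (hermitian_sym_form fK)) addrAC.
Qed.

End Slopes.

(** The adjoint identity turns [ip (adjoint ip fK T (T h)) h] into [[T h, T h]], so failure of each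
    semidefiniteness yields a vector of the opposite sign. *)
Lemma indefinite_quad (R : realType) (H K : completeNormedModType R[i])
    (ip : {dot H for @Num.conj R[i]}) (fK : {hermitian_sym K for @Num.conj R[i]})
    (T : {linear H -> K}) :
  induces_norm ip -> krein_space fK -> continuous T ->
  indefinite ip (adjoint ip fK T \o T) ->
  (exists h, 0 < quad (fun x y => fK (T x) (T y)) h) /\
  (exists h, quad (fun x y => fK (T x) (T y)) h < 0).
Proof.
move=> hH kK cT [npos nneg].
have adjq h : ip (adjoint ip fK T (T h)) h =
    (quad (fun x y => fK (T x) (T y)) h)%:C.
  rewrite (dot_form ip).2 -adjointE// (quadE (hermitian_comp fK T)).
  exact: conjc_real.
split; apply: contrapT => /forallNP noh; [apply: nneg | apply: npos] => h.
  by rewrite /= adjq lecR leNgt; apply/negP.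
by rewrite /= adjq lecR leNgt; apply/negP.
Qed.

(** * Optimality conditions for the constrained problem *)

Theorem theorem3p5 (R : realType)
    (H : completeNormedModType R[i]) (ip : {dot H for @Num.conj R[i]})
    (hH : induces_norm ip) (sepH : separable H)
    (K : completeNormedModType R[i])
    (fK : {hermitian_sym K for @Num.conj R[i]}) (hK : krein_space fK)
    (E : completeNormedModType R[i])
    (fE : {hermitian_sym E for @Num.conj R[i]}) (hE : krein_space fE)
    (T : {linear H -> K}) (cT : continuous T) (rT : closed (range T))
    (V : {linear H -> E}) (cV : continuous V) (sV : range V = setT)
    (indT : indefinite ip (adjoint ip fK T \o T))
    (indV : indefinite ip (adjoint ip fE V \o V))
    (Tnonneg : forall y, neutral_cone fE V y -> 0 <= fK (T y) (T y))
    (w0 : K) (z0 : E) (x : H) :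
  minimizers fK fE T V w0 z0 x <->
  exists lambda : R,
    [/\ rho_minus fK fE T V <= lambda <= rho_plus fK fE T V,
        adjoint ip fK T (T x) + lambda%:C *: adjoint ip fE V (V x) =
          adjoint ip fK T w0 + lambda%:C *: adjoint ip fE V z0
      & fE (V x - z0) (V x - z0) = 0].
Proof.
pose A := fun x y => fK (T x) (T y); pose B := fun x y => fE (V x) (V y).
have hA : hermitian_form A := hermitian_comp fK T.
have hB : hermitian_form B := hermitian_comp fE V.
have [hfK hfE] := (hermitian_sym_form fK, hermitian_sym_form fE).
have [Bpos Bneg] := indefinite_quad hH hE cV indV.
have AB h : quad B h = 0 -> 0 <= quad A h.
  move=> Bh; rewrite -lecR -(quadE hA); apply: Tnonneg.
  by rewrite /neutral_cone /= -[fE _ _]/(B h h) (quadE hB) Bh.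
have [_ pen] := pencil_interval hA hB Bpos Bneg AB.
rewrite rho_minusE rho_plusE -/A -/B.
set e := T x - w0; set d := V x - z0.
(* The difference of the two sides represents the functional [h |-> [T h, e] + l [V h, d]], [l]
   being real; evaluating at the difference itself forces it to vanish. *)
have stationary (l : R) :
    adjoint ip fK T (T x) + l%:C *: adjoint ip fE V (V x) =
      adjoint ip fK T w0 + l%:C *: adjoint ip fE V z0 <->
    forall h, fK (T h) e + l%:C * fE (V h) d = 0.
  have ipE h : fK (T h) e + l%:C * fE (V h) d =
      ip h (adjoint ip fK T (T x) + l%:C *: adjoint ip fE V (V x) -
            (adjoint ip fK T w0 + l%:C *: adjoint ip fE V z0)).
    have hip := dot_form ip.
    rewrite -scaleN1r !(hermitian_formDr hip, hermitian_formZr hip) -!adjointE//.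
    rewrite /e /d -[- w0]scaleN1r -[- z0]scaleN1r.
    rewrite (hermitian_formDr hfK) (hermitian_formZr hfK).
    rewrite (hermitian_formDr hfE) (hermitian_formZr hfE).
    rewrite (_ : (l%:C)^* = l%:C); last exact: conjc_real.
    by rewrite rmorphN rmorph1; ring.
  split=> [eq h|eq0]; first by rewrite ipE eq subrr linear0r.
  apply/eqP; rewrite -subr_eq0 -(dnorm_eq0 ip); apply/eqP.
  by rewrite -ipE.
have fE_quad y : fE (V y - z0) (V y - z0) = (quad fE (V y - z0))%:C by rewrite quadE.
have shiftT y := quad_shift fK T w0 x y.
have shiftV y := quad_shift fE V z0 x y.
split.
  move=> [feas opt]; have dd : quad fE d = 0.
    by move: feas; rewrite /feasible /= fE_quad => /complexI.
  have [l [lpos lst]] : exists l : R, (forall h, 0 <= quad A h + l * quad B h) /\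
      forall h, fK (T h) e + l%:C * fE (V h) d = 0.
    apply: inhomogeneous_multiplier => //.
    - by move=> a u v; rewrite linearP (hermitian_formDl hfK) (hermitian_formZl hfK).
    - by move=> a u v; rewrite linearP (hermitian_formDl hfE) (hermitian_formZl hfE).
    (* Since [quad fE d = 0], the hypothesis on [h] says exactly that [h + x] is feasible. *)
    move=> h Bh; have := opt (h + x).
    rewrite /feasible /= fE_quad !(quadE hfK) lecR (shiftT (h + x)) (shiftV (h + x)) addrK.
    rewrite -/e -/d dd addr0 -/A -/B Bh => /(_ erefl).
    by rewrite lerDr.
  by exists l; split => //; [apply/pen | apply/stationary].
move=> [l [/pen lpos /stationary lst feas]]; split=> // y.
rewrite /feasible /= fE_quad => /complexI feasy.
rewrite !(quadE hfK) lecR (shiftT y) -/e -/A lerDr.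
have dd : quad fE d = 0 by move: feas; rewrite fE_quad => /complexI.
move: feasy; rewrite shiftV -/d dd addr0 -/B => By.
(* Adding [l] times the vanishing constraint expansion to the objective increment cancels the linear
   terms by stationarity and leaves the nonnegative pencil at [y - x]. *)
have := lpos (y - x); have := congr1 (@complex.Re R) (lst (y - x)).
by move: By; case: (fK _ e) (fE _ d) => ? ? [? ?] /=; nra.
Qed.
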